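(* Let $F$ be a field with $\operatorname{char}(F)=2$. Then $m(F)\leq 2^{\nu(F)}$.
   Context: Let $F$ be a field of characteristic $2$. A quadratic form $q:V\to F$ on a finite-dimensional $F$-vector space has the polar form $B_q(v,w)=q(v+w)-q(v)-q(w)$; $q$ is nonsingular if $B_q$ is nondegenerate. It is anisotropic if $q(v)\neq 0$ for all $v\neq 0$, and universal if it represents every element of $F^\times$. The $m$-invariant $m(F)$ is the minimal dimension of a nonsingular anisotropic universal quadratic form over $F$, with $m(F)=\infty$ if no such form exists. Write $[1,a]$ for the form $x^2+xy+ay^2$. For $n\geq 1$, $b_1,\dots,b_{n-1}\in F^\times$ and $a\in F$, the quadratic $n$-fold Pfister form is $$\langle\!\langle b_1,\dots,b_{n-1},a]\!]=\perp_{i_1,\dots,i_{n-1}\in\{0,1\}} b_1^{i_1}\cdots b_{n-1}^{i_{n-1}}[1,a].$$ Let $I_qF=I_q^1F$ be the Witt group of nonsingular quadratic forms over $F$ (Witt classes modulo hyperbolic planes $[1,0]$, with operation $\perp$), and for $n\geq 1$ let $I_q^nF$ be the subgroup generated by the Witt classes of scalar multiples of quadratic $n$-fold Pfister forms. The invariant $\nu(F)$ is the minimal integer $n\geq 0$ such that $I_q^{n+1}F=0$ (equivalently, such that the Kato group $H_2^{n+1}(F)$, defined via differential forms and isomorphic to $I_q^{n+1}F/I_q^{n+2}F$, vanishes), with $\nu(F)=\infty$ if no such $n$ exists.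
   Formalization: The case ν(F)=0 is excluded, because there (e.g. F algebraically closed) every nonsingular form is hyperbolic, so no nonsingular anisotropic universal form exists, m(F)=∞, and the inequality m(F)≤1 is false. *)

(* Defs.v *)
From HB Require Import structures.
From mathcomp Require Import all_boot all_order all_algebra.
From mathcomp Require Import boolp ring.

Set Implicit Arguments.
Unset Strict Implicit.
Unset Printing Implicit Defensive.

Import GRing.Theory VectorInternalTheory.
Local Open Scope ring_scope.
Local Open Scope quotient_scope.

Section QuadraticSpaces.
Variable F : fieldType.

Definition polar (V : vectType F) (q : V -> F) (v w : V) : F :=
  q (v + w) - q v - q w.

Definition is_quadratic (V : vectType F) (q : V -> F) : Prop :=
  (forall (a : F) (v : V), q (a *: v) = a ^+ 2 * q v) /\
  bilinear_for *%R *%R (polar q).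

Record qspace := QSpace {
  qcarrier : vectType F;
  qform :> qcarrier -> F;
  qformP : is_quadratic qform }.

Implicit Types q p r : qspace.

Definition nonsingular q : Prop :=
  forall v, (forall w, polar q v w = 0) -> v = 0.

Definition anisotropic q : Prop := forall v, v != 0 -> q v != 0.

Definition universal q : Prop := forall c : F, c != 0 -> exists v, q v = c.

Definition qdim q : nat := \dim {: qcarrier q}.

Definition isometric q p : Prop :=
  exists f : {linear qcarrier q -> qcarrier p},
    bijective f /\ forall v, p (f v) = q v.

Lemma quad_scale q a v : q (a *: v) = a ^+ 2 * q v.
Proof. by have [h _] := qformP q; exact: h. Qed.

Lemma polarDr q v : {morph polar q v : w w' / w + w'}.
Proof.
have [_ [_ h]] := qformP q => w w'.
by have := h v 1 w w'; rewrite /= scale1r mul1r.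
Qed.

Lemma polarC q v w : polar q v w = polar q w v.
Proof. by rewrite /polar [v + w]addrC addrAC. Qed.

Lemma polarDl q w : {morph polar q ^~ w : v v' / v + v'}.
Proof. by move=> v v' /=; rewrite !(polarC _ w) polarDr. Qed.

Lemma quad0 q : q 0 = 0.
Proof. by rewrite -(scale0r (0 : qcarrier q)) quad_scale expr0n mul0r. Qed.

Lemma polar0r q v : polar q v 0 = 0.
Proof. by rewrite /polar addr0 subrr quad0 subr0. Qed.

Lemma polarZr q a v w : polar q v (a *: w) = a * polar q v w.
Proof.
have [_ [_ h]] := qformP q.
by have := h v a w 0; rewrite /= addr0 polar0r addr0.
Qed.

Lemma polarZl q a v w : polar q (a *: v) w = a * polar q v w.
Proof. by rewrite !(polarC _ w) polarZr. Qed.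

Lemma quadD q v w : q (v + w) = q v + q w + polar q v w.
Proof. by rewrite /polar; ring. Qed.

Lemma is_quadraticI (V : vectType F) (q : V -> F) :
    (forall a v, q (a *: v) = a ^+ 2 * q v) ->
    (forall v a w w', polar q v (a *: w + w') = a * polar q v w + polar q v w') ->
  is_quadratic q.
Proof.
move=> qZ qB; split=> //; split=> v a w w' /=; last exact: qB.
have pC x y : polar q x y = polar q y x by rewrite /polar [x + y]addrC addrAC.
by rewrite !(pC _ v) qB.
Qed.

Lemma quad_zero_subproof : is_quadratic (fun _ : 'rV[F]_0 => 0 : F).
Proof.
by apply: is_quadraticI => *; rewrite /polar ?subr0 ?mulr0 ?addr0.
Qed.
Definition qzero : qspace := QSpace quad_zero_subproof.

Definition osum_fun q p (v : qcarrier q * qcarrier p) : F := q v.1 + p v.2.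

Lemma polar_osum q p v w :
  polar (@osum_fun q p) v w = polar q v.1 w.1 + polar p v.2 w.2.
Proof. by rewrite /polar /osum_fun /=; ring. Qed.

Lemma osum_subproof q p : is_quadratic (@osum_fun q p).
Proof.
apply: is_quadraticI => [a v|v a w w'].
  by rewrite /osum_fun /= !quad_scale mulrDr.
by rewrite !polar_osum /= !polarDr !polarZr; ring.
Qed.
Definition osum q p : qspace := QSpace (osum_subproof q p).

Definition qscale_fun (c : F) q (v : qcarrier q) : F := c * q v.
Lemma polar_qscale c q v w :
  polar (@qscale_fun c q) v w = c * polar q v w.
Proof. by rewrite /polar /qscale_fun !mulrBr. Qed.

Lemma qscale_subproof c q : is_quadratic (@qscale_fun c q).
Proof.
apply: is_quadraticI => [a v|v a w w'].
  by rewrite /qscale_fun quad_scale mulrCA.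
by rewrite !polar_qscale polarDr polarZr mulrDr [c * (a * _)]mulrCA.
Qed.
Definition qscale (c : F) q : qspace := QSpace (qscale_subproof c q).

Definition binary_fun (a : F) (v : F^o * F^o) : F :=
  v.1 ^+ 2 + v.1 * v.2 + a * v.2 ^+ 2.

Lemma polar_binary a v w : polar (binary_fun a) v w =
  v.1 * w.1 *+ 2 + v.1 * w.2 + v.2 * w.1 + a * (v.2 * w.2) *+ 2.
Proof.
rewrite /polar /binary_fun /=; case: v w => v1 v2 [w1 w2] /=.
rewrite !mulr2n !expr2 !mulrDr !mulrDl; ring.
Qed.

Lemma binary_subproof a : is_quadratic (binary_fun a).
Proof.
apply: is_quadraticI => [b v|v b w w'].
  by rewrite /binary_fun /= /GRing.scale /=; ring.
by rewrite !polar_binary /= /GRing.scale /= !mulr2n; ring.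
Qed.
Definition binary (a : F) : qspace := QSpace (binary_subproof a).

Definition hyperbolic_plane : qspace := binary 0.

Definition hyperbolic (n : nat) : qspace :=
  iter n (osum hyperbolic_plane) qzero.

Definition witt_equiv q p : Prop :=
  exists m n, isometric (osum q (hyperbolic m)) (osum p (hyperbolic n)).

Lemma nonsingular_qzero : nonsingular qzero.
Proof. by move=> v _; apply/rowP; case. Qed.

Lemma nonsingular_osum q p :
  nonsingular q -> nonsingular p -> nonsingular (osum q p).
Proof.
move=> nq np [v1 v2] h.
have -> : v1 = 0.
  by apply: nq => w; have := h (w, 0); rewrite polar_osum /= polar0r addr0.
have -> // : v2 = 0.
by apply: np => w; have := h (0, w); rewrite polar_osum /= polar0r add0r.
Qed.

Lemma nonsingular_qscale c q :
  c != 0 -> nonsingular q -> nonsingular (qscale c q).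
Proof.
move=> c0 nq v h; apply: nq => w.
have := etrans (esym (@polar_qscale c q v w)) (h w).
by move/eqP; rewrite mulf_eq0 (negPf c0) => /eqP.
Qed.

Lemma nonsingular_hyperbolic_plane : nonsingular hyperbolic_plane.
Proof.
move=> [v1 v2] h.
have /= h1 := h (0, 1); have /= h2 := h (1, 0).
rewrite polar_binary /= in h1; rewrite polar_binary /= in h2.
have e1 : v1 = 0 by rewrite -h1; ring.
by have e2 : v2 = 0 by [rewrite -h2 e1; ring]; rewrite e1 e2.
Qed.

Lemma isometricI q p (f : qcarrier q -> qcarrier p) :
  linear f -> bijective f -> (forall v, p (f v) = q v) -> isometric q p.
Proof.
move=> lf bf fq; pose L := GRing.isLinear.Build _ _ _ _ f lf.
by pose g : {linear _ -> _} := HB.pack f L; exists g.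
Qed.

Lemma isometric_refl q : isometric q q.
Proof. by exists idfun; split=> //; exists id. Qed.

Lemma isometric_sym q p : isometric q p -> isometric p q.
Proof.
move=> [f [[g fK gK] fq]]; apply: (@isometricI _ _ g); last 2 first.
- by exists f.
- by move=> v; rewrite -fq gK.
by move=> a u v; apply: (can_inj fK); rewrite linearP !gK.
Qed.

Lemma isometric_trans q p r : isometric q p -> isometric p r -> isometric q r.
Proof.
move=> [f [bf fq]] [g [bg gp]]; exists (g \o f); split.
  exact: bij_comp.
by move=> v /=; rewrite gp.
Qed.

Lemma isometric_osum q q' p p' :
  isometric q q' -> isometric p p' -> isometric (osum q p) (osum q' p').
Proof.
move=> [f [[f' fK f'K] fq]] [g [[g' gK g'K] gp]].
apply: (@isometricI (osum q p) (osum q' p') (fun v => (f v.1, g v.2))).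
- by move=> a u v /=; rewrite !linearP.
- by exists (fun v => (f' v.1, g' v.2)) => -[v w] /=; rewrite ?fK ?gK ?f'K ?g'K.
- by move=> v /=; rewrite /osum_fun /= fq gp.
Qed.

Lemma osumC q p : isometric (osum q p) (osum p q).
Proof.
apply: (@isometricI (osum q p) (osum p q) (fun v => (v.2, v.1))) => //.
- by exists (fun v => (v.2, v.1)) => -[].
- by move=> v; rewrite /= /osum_fun /= addrC.
Qed.

Lemma osumA q p r : isometric (osum q (osum p r)) (osum (osum q p) r).
Proof.
apply: (@isometricI (osum q (osum p r)) (osum (osum q p) r)
  (fun v => ((v.1, v.2.1), v.2.2))) => //.
- by exists (fun v => (v.1.1, (v.1.2, v.2))) => [[? []]|[[]]].
- by move=> v; rewrite /= /osum_fun /= addrA.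
Qed.

Lemma osum0 q : isometric (osum q qzero) q.
Proof.
apply: (@isometricI (osum q qzero) q (fun v => v.1)) => //.
- exists (fun v => (v, 0)) => // -[v w] /=; congr pair.
  by apply/rowP; case.
- by move=> v; rewrite /= /osum_fun /= addr0.
Qed.

Lemma osumACA q q' p p' :
  isometric (osum (osum q p) (osum q' p')) (osum (osum q q') (osum p p')).
Proof.
apply: (@isometricI (osum (osum q p) (osum q' p'))
  (osum (osum q q') (osum p p'))
  (fun v => ((v.1.1, v.2.1), (v.1.2, v.2.2)))) => //.
- by exists (fun v => ((v.1.1, v.2.1), (v.1.2, v.2.2))) => -[[? ?] []].
- by move=> v; rewrite /= /osum_fun /= addrACA.
Qed.

Lemma hyperbolicD m n :
  isometric (osum (hyperbolic m) (hyperbolic n)) (hyperbolic (m + n)).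
Proof.
elim: m => [|m IH]; first exact: isometric_trans (osumC _ _) (osum0 _).
apply: isometric_trans (isometric_sym (osumA _ _ _)) _.
exact: isometric_osum (isometric_refl _) IH.
Qed.

Lemma isometric_witt q p : isometric q p -> witt_equiv q p.
Proof. by move=> h; exists 0%N, 0%N; apply: isometric_osum h (isometric_refl _). Qed.

Lemma witt_refl q : witt_equiv q q.
Proof. exact/isometric_witt/isometric_refl. Qed.

Lemma witt_sym q p : witt_equiv q p -> witt_equiv p q.
Proof. by move=> [m [n h]]; exists n, m; apply: isometric_sym. Qed.

Lemma hyperbolic_shift q m n : isometric
  (osum (osum q (hyperbolic m)) (hyperbolic n)) (osum q (hyperbolic (m + n))).
Proof.
apply: isometric_trans (isometric_sym (osumA _ _ _)) _.
exact: isometric_osum (isometric_refl _) (hyperbolicD _ _).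
Qed.

Lemma witt_trans q p r : witt_equiv q p -> witt_equiv p r -> witt_equiv q r.
Proof.
move=> [a [b h]] [c [d k]]; exists (a + c)%N, (d + b)%N.
apply: isometric_trans (isometric_sym (hyperbolic_shift _ _ _)) _.
apply: isometric_trans (isometric_osum h (isometric_refl _)) _.
apply: isometric_trans (hyperbolic_shift _ _ _) _.
apply: isometric_trans _ (hyperbolic_shift _ _ _).
apply: isometric_trans _ (isometric_osum k (isometric_refl _)).
by rewrite addnC; apply: isometric_sym; apply: hyperbolic_shift.
Qed.

Lemma witt_osum q q' p p' :
  witt_equiv q q' -> witt_equiv p p' -> witt_equiv (osum q p) (osum q' p').
Proof.
move=> [a [b h]] [c [d k]]; exists (a + c)%N, (b + d)%N.
apply: isometric_trans (isometric_osum (isometric_refl _)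
  (isometric_sym (hyperbolicD _ _))) _.
apply: isometric_trans (osumACA _ _ _ _) _.
apply: isometric_trans (isometric_osum h k) _.
apply: isometric_trans (osumACA _ _ _ _) _.
exact: isometric_osum (isometric_refl _) (hyperbolicD _ _).
Qed.

Definition pairing_fun n (v : 'rV[F]_n * 'rV[F]_n) : F :=
  \sum_i v.1 0 i * v.2 0 i.

Lemma pairing_subproof n : is_quadratic (@pairing_fun n).
Proof.
have pol v w : polar (@pairing_fun n) v w =
    \sum_i (v.1 0 i * w.2 0 i + w.1 0 i * v.2 0 i).
  rewrite /polar /pairing_fun -!sumrB; apply: eq_bigr => i _ /=.
  by rewrite !mxE; ring.
apply: is_quadraticI => [a v|v a w w'].
  rewrite /pairing_fun mulr_sumr; apply: eq_bigr => i _ /=.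
  by rewrite !mxE; ring.
rewrite !pol mulr_sumr -big_split /=; apply: eq_bigr => i _.
by rewrite !mxE; ring.
Qed.
Definition pairing n := QSpace (@pairing_subproof n).

Lemma pairing_hyperbolic n : isometric (pairing n) (hyperbolic n).
Proof.
elim: n => [|n IH].
  apply: (@isometricI (pairing 0) qzero (fun v => v.1)) => //.
    by exists (fun v => (v, v)) => [[v w]|v] //=; congr pair; apply/rowP; case.
  by move=> v; rewrite /= /pairing_fun big_ord0.
apply: isometric_trans _ (isometric_osum (isometric_refl _) IH).
pose tl (x : 'rV[F]_n.+1) : 'rV[F]_n := \row_j x 0 (lift ord0 j).
pose cns (a : F) (x : 'rV[F]_n) : 'rV[F]_n.+1 :=
  \row_i if unlift ord0 i is Some j then x 0 j else a.
have cns0 a x : cns a x 0 ord0 = a by rewrite mxE unlift_none.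
have cnsS a x j : cns a x 0 (lift ord0 j) = x 0 j by rewrite mxE liftK.
have tlP a x y : tl (a *: x + y) = a *: tl x + tl y.
  by apply/rowP => j; rewrite !mxE.
have tlK a x : tl (cns a x) = x by apply/rowP => j; rewrite mxE cnsS.
have cnsK (x : 'rV[F]_n.+1) : cns (x 0 ord0) (tl x) = x.
  apply/rowP => i; rewrite mxE; case: unliftP => [j|] -> //.
  by rewrite mxE.
apply: (@isometricI (pairing n.+1) (osum hyperbolic_plane (pairing n))
  (fun v => ((v.1 0 ord0 : F^o, v.2 0 ord0 - v.1 0 ord0 : F^o),
             (tl v.1, tl v.2)))).
- move=> a [x y] [x' y'] /=; rewrite !tlP !mxE.
  congr (_, _, _); rewrite /= /GRing.scale /=; ring.
- exists (fun w => (cns w.1.1 w.2.1, cns (w.1.2 + w.1.1) w.2.2)).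
    by move=> [x y] /=; rewrite subrK !cnsK.
  by move=> [[a b] [x y]] /=; rewrite !cns0 !tlK addrK.
- move=> [x y] /=; rewrite /osum_fun /= /binary_fun /pairing_fun /=.
  rewrite [RHS]big_ord_recl /=; congr (_ + _); first by ring.
  by apply: eq_bigr => i _; rewrite !mxE.
Qed.

Lemma quad_sum q n (w : 'I_n -> qcarrier q) : q (\sum_i w i) =
  \sum_i (q (w i) + \sum_(j < n | (i < j)%N) polar q (w i) (w j)).
Proof.
have polar_sum m v (u : 'I_m -> qcarrier q) :
    polar q v (\sum_i u i) = \sum_i polar q v (u i).
  by apply: (big_morph (polar q v)); [apply: polarDr | apply: polar0r].
elim: n w => [|n IH] w; first by rewrite !big_ord0 quad0.
rewrite !big_ord_recl quadD IH polar_sum addrAC; congr (_ + _ + _).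
  by rewrite [RHS]big_mkcond [RHS]big_ord_recl /= add0r.
apply: eq_bigr => i _; congr (_ + _).
by rewrite [RHS]big_mkcond [RHS]big_ord_recl /= add0r -big_mkcond.
Qed.

(* The diagonal is a Lagrangian of q _|_ -q: in the coordinates u = v - w and
   y_i = B(v, e_i) - beta(u, e_i), where beta is a bilinear form such that
   beta(u, u) = q(u), one has q(v) - q(w) = B(v, u) - q(u) = sum_i u_i y_i. *)
Lemma osum_opp q : nonsingular q ->
  isometric (osum q (qscale (-1) q)) (hyperbolic (qdim q)).
Proof.
move=> nq; apply: isometric_trans _ (pairing_hyperbolic _).
set V := qcarrier q; set n := qdim q.
pose e := vbasis {: V}; pose x i (v : V) := coord e i v.
have xE (v : V) : v = \sum_i x i v *: e`_i.
  by rewrite -coord_vbasis // memvf.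
have xP i a u v : x i (a *: u + v) = a * x i u + x i v by rewrite /x linearP.
pose beta (u : V) j := x j u * q e`_j +
  \sum_(i < n | (i < j)%N) x i u * polar q e`_i e`_j.
have betaP j a u v : beta (a *: u + v) j = a * beta u j + beta v j.
  rewrite /beta xP mulrDr mulr_sumr.
  under eq_bigr => i _ do rewrite xP mulrDl.
  rewrite big_split /=; under eq_bigr => i _ do rewrite -mulrA.
  by ring.
have betaE u : \sum_j x j u * beta u j = q u.
  rewrite [in RHS](xE u) quad_sum /beta.
  under eq_bigr => j _ do rewrite mulrDr mulr_sumr.
  rewrite big_split /= [in RHS]big_split /=; congr (_ + _).
    by apply: eq_bigr => i _; rewrite quad_scale mulrA.
  rewrite (exchange_big_dep xpredT) //=.
  apply: eq_bigr => i _; apply: eq_bigr => j _.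
  by rewrite polarZl polarZr mulrCA.
have polE v u : polar q v u = \sum_j x j u * polar q v e`_j.
  rewrite [in LHS](xE u) (big_morph (polar q v) (polarDr v) (polar0r v)).
  by apply: eq_bigr => j _; rewrite polarZr.
pose f (v : V * V) : 'rV[F]_n * 'rV[F]_n :=
  (\row_i x i (v.1 - v.2), \row_i (polar q v.1 e`_i - beta (v.1 - v.2) i)).
have lf : linear f.
  move=> a [u v] [u' v']; rewrite /f /=.
  have -> : a *: u + u' - (a *: v + v') = a *: (u - v) + (u' - v').
    by rewrite opprD addrACA scalerBr.
  congr pair; apply/rowP => i; rewrite !mxE ?xP ?betaP //.
  by rewrite polarDl polarZl; ring.
pose L := GRing.isLinear.Build _ _ _ _ f lf.
pose g : {linear (V * V)%type -> _} := HB.pack f L.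
have ker0 v : f v = 0 -> v = 0.
  case: v => v w [/rowP h1 /rowP h2].
  have uE : v - w = 0.
    rewrite [LHS]xE big1 // => i _.
    by have := h1 i; rewrite !mxE /= => ->; rewrite scale0r.
  have v0 : v = 0.
    apply: nq => z; rewrite polE big1 // => i _.
    have := h2 i; rewrite !mxE /= uE.
    suff -> : beta 0 i = 0 by rewrite subr0 => ->; rewrite mulr0.
    have := betaP i 1 0 0; rewrite scale1r mul1r addr0 -{1}[beta 0 i]addr0.
    by move/addrI.
  by move: uE; rewrite v0 sub0r => /eqP; rewrite oppr_eq0 => /eqP ->.
apply: (@isometricI (osum q (qscale (-1) q)) (pairing n) f) => //; last first.
  move=> [v w]; rewrite /= /osum_fun /= /qscale_fun /pairing_fun /=.
  under eq_bigr => i _ do rewrite !mxE mulrBr.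
  rewrite sumrB -polE betaE.
  have -> : w = v + (-1) *: (v - w) by rewrite scaleN1r opprB addrC subrK.
  set u := v - w.
  have -> : v - (v + (-1) *: u) = u by rewrite opprD addNKr scaleN1r opprK.
  by rewrite quadD quad_scale polarZr; ring.
have kg : lker (linfun g) == 0%VS.
  by apply/lker0P => u v; rewrite !lfunE /= => h; apply/eqP;
     rewrite -subr_eq0; apply/eqP/ker0; rewrite -[f _]/(g _) linearB /= h subrr.
have gfull : limg (linfun g) = fullv.
  apply/eqP; rewrite eqEdim subvf /= limg_dim_eq; last first.
    by rewrite (eqP kg) capv0.
  rewrite !dimvf; apply: (@eq_leq (1 * n + 1 * n)).
  by rewrite !mul1n /n /qdim dimvf.
exists (linfun g)^-1%VF => v.
  by have := lker0_lfunK kg v; rewrite lfunE.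
have := @limg_lfunVK _ _ _ (linfun g) v; rewrite gfull memvf lfunE => /(_ isT) h; exact: h.
Qed.

Record nsform := NSForm {
  nsform_val :> qspace;
  nsformP : nonsingular nsform_val }.

(* The nonsingular forms on all vector spaces live in too large a universe to
   carry a choiceType structure, so the Witt group is built as a quotient of
   the forms on the spaces F^d; [witt_class] is defined on all nonsingular
   forms by choosing coordinates, and [witt_classP] shows that the choice does
   not matter. *)
Record coord_form := CoordForm {
  cf_dim : nat;
  cf_fun : 'rV[F]_cf_dim -> F;
  cf_quadratic : is_quadratic cf_fun;
  cf_nonsingular : nonsingular (QSpace cf_quadratic) }.

HB.instance Definition _ := gen_eqMixin coord_form.
HB.instance Definition _ := gen_choiceMixin coord_form.

Definition ns_of_coord (x : coord_form) : nsform := NSForm (@cf_nonsingular x).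

Lemma coord_subproof (q : nsform) : is_quadratic (fun x => q (r2v x)).
Proof.
apply: is_quadraticI => [a v|v a w w'].
  by rewrite linearZ quad_scale.
by rewrite /polar !linearD !linearZ -!/(polar q _ _) polarDr polarZr.
Qed.

Lemma coord_isometric (q : nsform) : isometric (QSpace (coord_subproof q)) q.
Proof.
by exists r2v; split=> //; exists v2r; [apply: r2vK | apply: v2rK].
Qed.

Lemma isometric_nonsingular q p :
  isometric q p -> nonsingular p -> nonsingular q.
Proof.
move=> [f [[g fK gK] fq]] np v h; apply: (can_inj fK); rewrite linear0.
apply: np => w; rewrite -(h (g w)) -{1}[w]gK.
by rewrite /polar -!fq linearD.
Qed.

Definition coord_of_ns (q : nsform) : coord_form :=
  CoordForm (isometric_nonsingular (coord_isometric q) (@nsformP q)).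

Definition witt_rel (x y : coord_form) : bool :=
  `[< witt_equiv (ns_of_coord x) (ns_of_coord y) >].

Lemma witt_rel_equiv : equiv_class_of witt_rel.
Proof.
split=> [x|x y|y x z].
- exact/asboolP/witt_refl.
- by apply/asboolP/asboolP; apply: witt_sym.
- by move=> /asboolP xy /asboolP yz; apply/asboolP; apply: witt_trans xy yz.
Qed.
Canonical witt_equiv_rel := EquivRelPack witt_rel_equiv.

Definition witt_group : Type := {eq_quot witt_rel}.
HB.instance Definition _ := Choice.on witt_group.
HB.instance Definition _ := EqQuotient.on witt_group.

Definition witt_class (q : nsform) : witt_group := \pi_witt_group (coord_of_ns q).

Lemma witt_classP (q p : nsform) :
  witt_class q = witt_class p <-> witt_equiv q p.
Proof.
have qC := isometric_witt (coord_isometric q).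
have pC := isometric_witt (coord_isometric p).
split=> [/eqP|h].
  rewrite eqmodE => /asboolP h.
  exact: witt_trans (witt_sym qC) (witt_trans h pC).
apply/eqP; rewrite eqmodE; apply/asboolP.
exact: witt_trans qC (witt_trans h (witt_sym pC)).
Qed.

Definition witt_repr (x : witt_group) : nsform := ns_of_coord (repr x).

Lemma witt_reprK x : witt_class (witt_repr x) = x.
Proof.
rewrite -[RHS]reprK; apply/eqP; rewrite eqmodE; apply/asboolP.
exact: isometric_witt (coord_isometric (witt_repr x)).
Qed.

Lemma witt_class_surj (x : witt_group) : exists q : nsform, x = witt_class q.
Proof. by exists (witt_repr x); rewrite witt_reprK. Qed.

Definition ns_zero : nsform := NSForm nonsingular_qzero.
Definition ns_osum (q p : nsform) : nsform :=
  NSForm (nonsingular_osum (@nsformP q) (@nsformP p)).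
Fact neg1_neq0 : (-1 : F) != 0.
Proof. by rewrite oppr_eq0 oner_neq0. Qed.
Definition ns_opp (q : nsform) : nsform :=
  NSForm (nonsingular_qscale neg1_neq0 (@nsformP q)).

Definition witt_add (x y : witt_group) : witt_group :=
  witt_class (ns_osum (witt_repr x) (witt_repr y)).
Definition witt_opp (x : witt_group) : witt_group :=
  witt_class (ns_opp (witt_repr x)).

Lemma witt_addE (q p : nsform) :
  witt_add (witt_class q) (witt_class p) = witt_class (ns_osum q p).
Proof. by apply/witt_classP; apply: witt_osum; apply/witt_classP; apply: witt_reprK. Qed.

Lemma witt_hyperbolic n : witt_equiv (hyperbolic n) qzero.
Proof.
exists 0%N, n; apply: isometric_trans (osum0 _) _.
exact: isometric_trans (isometric_sym (osum0 _)) (osumC _ _).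
Qed.

Fact witt_addA : associative witt_add.
Proof.
move=> x y z; have [q ->] := witt_class_surj x.
have [p ->] := witt_class_surj y; have [r ->] := witt_class_surj z.
by rewrite !witt_addE; apply/witt_classP/isometric_witt/osumA.
Qed.

Fact witt_addC : commutative witt_add.
Proof.
move=> x y; have [q ->] := witt_class_surj x; have [p ->] := witt_class_surj y.
by rewrite !witt_addE; apply/witt_classP/isometric_witt/osumC.
Qed.

Fact witt_add0 : left_id (witt_class ns_zero) witt_add.
Proof.
move=> x; have [q ->] := witt_class_surj x; rewrite witt_addC witt_addE.
by apply/witt_classP/isometric_witt/osum0.
Qed.

Fact witt_addN : left_inverse (witt_class ns_zero) witt_opp witt_add.
Proof.
move=> x; rewrite witt_addC -{1}[x]witt_reprK witt_addE; apply/witt_classP.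
exact: witt_trans (isometric_witt (osum_opp (@nsformP (witt_repr x))))
  (witt_hyperbolic _).
Qed.

HB.instance Definition _ :=
  GRing.isZmodule.Build witt_group witt_addA witt_addC witt_add0 witt_addN.

Lemma witt_classD (q p : nsform) :
  witt_class (ns_osum q p) = witt_class q + witt_class p.
Proof. by rewrite -witt_addE. Qed.

Lemma witt_class0 : witt_class ns_zero = 0.
Proof. by []. Qed.

(* The quadratic n-fold Pfister form <<b_1, ..., b_(n-1), a]], for n >= 1. *)
Definition pfister (n : nat) (b : 'I_n.-1 -> F) (a : F) : qspace :=
  \big[osum/qzero]_(i : {ffun 'I_n.-1 -> bool})
    qscale (\prod_j b j ^+ i j) (binary a).

Lemma nonsingular_pfister n (b : 'I_n.-1 -> F) a :
    2%N \in [pchar F] -> (forall j, b j != 0) -> nonsingular (pfister b a).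
Proof.
move=> F2 b0; apply: big_ind => [||i _].
- exact: nonsingular_qzero.
- exact: nonsingular_osum.
apply: nonsingular_qscale.
  by apply/prodf_neq0 => j _; rewrite expf_neq0.
have two0 (x : F) : x + x = 0 by rewrite addrr_pchar2.
move=> [v1 v2] h.
have /= h1 := h (0, 1); have /= h2 := h (1, 0).
rewrite polar_binary /= mulr2n two0 in h1; rewrite polar_binary /= !mulr2n !two0 in h2.
have e2 : v2 = 0 by rewrite -h2; ring.
have e1 : v1 = 0 by rewrite -h1 e2; ring.
by rewrite e1 e2.
Qed.

End QuadraticSpaces.

Inductive subgroup_span (A : zmodType) (S : A -> Prop) : A -> Prop :=
| span_gen x : S x -> subgroup_span S x
| span_0 : subgroup_span S 0
| span_sub x y :
    subgroup_span S x -> subgroup_span S y -> subgroup_span S (x - y).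

Section Invariants.
Variable F : fieldType.

Definition scaled_pfister_class (n : nat) (w : witt_group F) : Prop :=
  exists (c : F) (b : 'I_n.-1 -> F) (a : F)
         (ns : nonsingular (qscale c (pfister b a))),
    [/\ c != 0, forall j, b j != 0 & w = witt_class (NSForm ns)].

(* I_q^n F, for n >= 1; at n = 1 this is the whole Witt group when F has
   characteristic 2. *)
Definition Iq (n : nat) : witt_group F -> Prop :=
  subgroup_span (scaled_pfister_class n).

End Invariants.

Variant extnat := Fin of nat | Infty.

Definition extnat_le (x y : extnat) : Prop :=
  match x, y with
  | _, Infty => True
  | Infty, Fin _ => False
  | Fin m, Fin n => (m <= n)%N
  end.

Definition extnat_exp2 (x : extnat) : extnat :=
  if x is Fin n then Fin (2 ^ n) else Infty.

Definition extnat_min (P : nat -> Prop) : extnat :=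
  match pselect (exists n, `[< P n >]) with
  | left exP => Fin (ex_minn exP)
  | right _ => Infty
  end.

Lemma extnat_minP (P : nat -> Prop) :
  match extnat_min P with
  | Fin n => P n /\ forall m, P m -> (n <= m)%N
  | Infty => forall m, ~ P m
  end.
Proof.
rewrite /extnat_min; case: pselect => [exP|nP].
  by case: ex_minnP => n /asboolP Pn min; split=> // m /asboolP; apply: min.
by move=> m Pm; apply: nP; exists m; apply/asboolP.
Qed.

Definition m_invariant (F : fieldType) : extnat :=
  extnat_min (fun d => exists q : qspace F,
    [/\ qdim q = d, nonsingular q, anisotropic q & universal q]).

(* When F has characteristic 2 and nu F = Fin 0, every nonsingular form is
   hyperbolic, hence m_invariant F = Infty; so m(F) <= 2^nu(F) can only hold
   when nu F is not Fin 0. *)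
Definition nu (F : fieldType) : extnat :=
  extnat_min (fun n => forall w : witt_group F, Iq n.+1 w -> w = 0).

(* Main.v *)
(* A generator of I_q^n with nonzero Witt class is a scaled n-fold Pfister form
   s phi. Let q be its anisotropic part: it is nonzero, of dimension at most
   2^n. For c != 0, q _|_ cq is Witt equivalent to s (phi _|_ c phi), a scaled
   (n+1)-fold Pfister form, so it is Witt trivial and contains a totally
   isotropic subspace of dimension dim q. As cq is anisotropic, this subspace
   projects isomorphically onto the first summand: for every v there is w such
   that q(v) = - c q(w). Fixing v != 0 and varying c shows that q is universal. *)
Require Import Defs.
From HB Require Import structures.
From mathcomp Require Import all_boot all_order all_algebra.
From mathcomp Require Import boolp ring.
Import GRing.Theory.
Local Open Scope ring_scope.

Set Implicit Arguments.
Unset Strict Implicit.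
Unset Printing Implicit Defensive.

(** * Scalar multiples and Witt equivalence *)

Section Scaling.
Variable F : fieldType.
Implicit Types (q p : qspace F) (c d : F).

Lemma isometric_qscale c q p :
  isometric q p -> isometric (qscale c q) (qscale c p).
Proof.
move=> [f [bf fq]]; exists f; split=> // v.
by rewrite /= /qscale_fun fq.
Qed.

Lemma qscale_osum c q p :
  isometric (qscale c (osum q p)) (osum (qscale c q) (qscale c p)).
Proof.
apply: (@isometricI _ (qscale c (osum q p)) (osum (qscale c q) (qscale c p)) id).
- by [].
- by exists id.
- by move=> v; rewrite /= /qscale_fun /= /osum_fun /= mulrDr.
Qed.

Lemma qscaleA c d q : isometric (qscale c (qscale d q)) (qscale (c * d) q).
Proof.
apply: (@isometricI _ (qscale c (qscale d q)) (qscale (c * d) q) id) => //.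
- by exists id.
- by move=> v; rewrite /= /qscale_fun /= /qscale_fun mulrA.
Qed.

Lemma qscale_qzero c : isometric (qscale c (qzero F)) (qzero F).
Proof.
apply: (@isometricI _ (qscale c (qzero F)) (qzero F) id) => //.
- by exists id.
- by move=> v; rewrite /= /qscale_fun mulr0.
Qed.

Lemma qscale_hyperbolic_plane c : c != 0 ->
  isometric (qscale c (hyperbolic_plane F)) (hyperbolic_plane F).
Proof.
move=> c0.
(* The plane is the product x^2 + xy = x(x + y); the map multiplies the factor x by c and keeps the
   factor x + y. *)
apply: (@isometricI _ (qscale c (hyperbolic_plane F)) (hyperbolic_plane F)
  (fun v => (c * v.1 : F^o, v.1 + v.2 - c * v.1 : F^o))).
- by move=> a [x y] [x' y']; congr pair; rewrite /= /GRing.scale /=; ring.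
- exists (fun v => (c^-1 * v.1 : F^o, v.1 + v.2 - c^-1 * v.1 : F^o)).
    by move=> [x y] /=; rewrite mulKf //; congr pair; ring.
  by move=> [x y] /=; rewrite mulVKf //; congr pair; ring.
- by move=> [x y]; rewrite /= /qscale_fun /= /binary_fun /=; ring.
Qed.

Lemma qscale_hyperbolic c n : c != 0 ->
  isometric (qscale c (hyperbolic F n)) (hyperbolic F n).
Proof.
move=> c0; elim: n => [|n IH]; first exact: qscale_qzero.
apply: isometric_trans (qscale_osum _ _ _) _.
exact: isometric_osum (qscale_hyperbolic_plane c0) IH.
Qed.

Lemma witt_qscale c q p : c != 0 ->
  witt_equiv q p -> witt_equiv (qscale c q) (qscale c p).
Proof.
move=> c0 [m [n h]]; exists m, n.
have aux r k : isometric (osum (qscale c r) (hyperbolic F k))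
    (qscale c (osum r (hyperbolic F k))).
  apply: isometric_trans _ (isometric_sym (qscale_osum _ _ _)).
  exact: isometric_osum (isometric_refl _) (isometric_sym (qscale_hyperbolic k c0)).
apply: isometric_trans (aux q m) _; apply: isometric_trans _ (isometric_sym (aux p n)).
exact: isometric_qscale.
Qed.

End Scaling.

(** * Iterated orthogonal sums *)

Section BigOsum.
Variables (F : fieldType) (I : Type).
Implicit Types (s t : seq I) (G : I -> qspace F).

Lemma big_osum_cat s t G :
  isometric (\big[@osum F/qzero F]_(i <- s ++ t) G i)
    (osum (\big[@osum F/qzero F]_(i <- s) G i) (\big[@osum F/qzero F]_(i <- t) G i)).
Proof.
elim: s => [|i s IH] /=.
  rewrite big_nil; apply: isometric_sym.
  exact: isometric_trans (osumC _ _) (osum0 _).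
rewrite !big_cons; apply: isometric_trans _ (osumA _ _ _).
exact: isometric_osum (isometric_refl _) IH.
Qed.

Lemma isometric_big s G H : (forall i, isometric (G i) (H i)) ->
  isometric (\big[@osum F/qzero F]_(i <- s) G i) (\big[@osum F/qzero F]_(i <- s) H i).
Proof.
move=> GH; elim: s => [|i s IH]; first by rewrite !big_nil; apply: isometric_refl.
by rewrite !big_cons; apply: isometric_osum.
Qed.

Lemma qscale_big c s G : isometric (qscale c (\big[@osum F/qzero F]_(i <- s) G i))
  (\big[@osum F/qzero F]_(i <- s) qscale c (G i)).
Proof.
elim: s => [|i s IH]; first by rewrite !big_nil; apply: qscale_qzero.
rewrite !big_cons; apply: isometric_trans (qscale_osum _ _ _) _.
exact: isometric_osum (isometric_refl _) IH.
Qed.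

End BigOsum.

(** [osum] is commutative and associative only up to isometry, so reindexing goes through exchanges
    of adjacent blocks, which generate all permutations. *)
Lemma big_osum_perm (F : fieldType) (I : eqType) (s t : seq I) (G : I -> qspace F) :
  perm_eq s t ->
  isometric (\big[@osum F/qzero F]_(i <- s) G i) (\big[@osum F/qzero F]_(i <- t) G i).
Proof.
move=> st; pose P u := isometric (\big[@osum F/qzero F]_(i <- s) G i)
                                 (\big[@osum F/qzero F]_(i <- u) G i).
apply: (@catCA_perm_ind _ P _ s t st); last exact: isometric_refl.
move=> s1 s2 s3 h; apply: isometric_trans h _.
apply: isometric_trans (big_osum_cat _ _ _) _.
apply: isometric_trans (isometric_osum (isometric_refl _) (big_osum_cat _ _ _)) _.
apply: isometric_trans (osumA _ _ _) _.
apply: isometric_trans (isometric_osum (osumC _ _) (isometric_refl _)) _.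
apply: isometric_trans (isometric_sym (osumA _ _ _)) _.
apply: isometric_sym; apply: isometric_trans (big_osum_cat _ _ _) _.
exact: isometric_osum (isometric_refl _) (big_osum_cat _ _ _).
Qed.

(** * The recursive structure of Pfister forms *)

Section Pfister.
Variable F : fieldType.

Definition fcons n (T : Type) (x : T) (f : 'I_n -> T) (i : 'I_n.+1) : T :=
  if unlift ord0 i is Some j then f j else x.

Lemma fcons0 n T x (f : 'I_n -> T) : fcons x f ord0 = x.
Proof. by rewrite /fcons unlift_none. Qed.

Lemma fconsS n T x (f : 'I_n -> T) j : fcons x f (lift ord0 j) = f j.
Proof. by rewrite /fcons liftK. Qed.

(** Grouping exponent vectors by their first entry separates the terms of a Pfister form that
    contain the first slot from those that do not. *)
Lemma enum_ffunS n : perm_eq (index_enum {ffun 'I_n.+1 -> bool})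
  ([seq [ffun i => fcons false f i] | f : {ffun 'I_n -> bool} <- index_enum _] ++
   [seq [ffun i => fcons true f i] | f : {ffun 'I_n -> bool} <- index_enum _]).
Proof.
pose cns x (f : {ffun 'I_n -> bool}) : {ffun 'I_n.+1 -> bool} := [ffun i => fcons x f i].
have cns_inj x : injective (cns x).
  move=> f g /ffunP e; apply/ffunP => j.
  by have := e (lift ord0 j); rewrite !ffunE !fconsS.
apply: uniq_perm; first exact: index_enum_uniq.
  rewrite cat_uniq !map_inj_uniq ?index_enum_uniq ?andbT /=; try exact: cns_inj.
  apply/hasPn => _ /mapP [f _ ->]; apply/mapP => -[g _ /ffunP /(_ ord0)].
  by rewrite !ffunE !fcons0.
move=> g; rewrite mem_index_enum mem_cat; apply/esym.
suff : g \in map (cns (g ord0)) (index_enum _).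
  by case: (g ord0) => ->; rewrite ?orbT.
apply/mapP; exists [ffun j => g (lift ord0 j)]; first exact: mem_index_enum.
apply/ffunP => i; rewrite ffunE; case: (unliftP ord0 i) => [j|] ->.
  by rewrite fconsS ffunE.
by rewrite fcons0.
Qed.

(** The terms with exponent 0 at the new slot form the first summand; those with exponent 1 share
    the factor c and form the second. *)
Lemma pfister_cons n (c : F) (b : 'I_n -> F) a :
  isometric (@pfister F n.+2 (fcons c b) a)
    (osum (@pfister F n.+1 b a) (qscale c (@pfister F n.+1 b a))).
Proof.
apply: isometric_trans (big_osum_perm _ (enum_ffunS n)) _.
apply: isometric_trans (big_osum_cat _ _ _) _.
have prodE x (f : {ffun 'I_n -> bool}) :
    \prod_(j < n.+1) fcons c b j ^+ [ffun i => fcons x f i] j =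
    c ^+ x * \prod_j b j ^+ f j.
  rewrite big_ord_recl ffunE !fcons0; congr (_ * _).
  by apply: eq_bigr => j _; rewrite ffunE !fconsS.
apply: isometric_osum; rewrite big_map.
  apply: isometric_big => f; rewrite prodE expr0 mul1r.
  exact: isometric_refl.
apply: isometric_trans _ (isometric_sym (qscale_big _ _ _)).
apply: isometric_big => f; rewrite prodE expr1.
exact: isometric_sym (qscaleA _ _ _).
Qed.

End Pfister.

(** * Dimensions of quadratic spaces *)

Section Dimension.
Variable F : fieldType.
Implicit Types q p : qspace F.

Lemma qdim_osum q p : qdim (osum q p) = (qdim q + qdim p)%N.
Proof. by rewrite /qdim !dimvf. Qed.

Lemma qdim_binary (a : F) : qdim (binary a) = 2%N.
Proof. by rewrite /qdim dimvf. Qed.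

Lemma qdim_qzero : qdim (qzero F) = 0%N.
Proof. by rewrite /qdim dimvf. Qed.

Lemma linfun_inj_dim (V W : vectType F) (f : {linear V -> W}) (U : {vspace V}) :
  injective f -> \dim (linfun f @: U)%VS = \dim U.
Proof.
move=> fi; apply: limg_dim_eq; apply/eqP.
have /eqP -> : lker (linfun f) == 0%VS.
  by apply/lker0P => u v; rewrite !lfunE; apply: fi.
by rewrite capv0.
Qed.

Lemma isometric_qdim q p : isometric q p -> qdim q = qdim p.
Proof.
have le q' p' : isometric q' p' -> (qdim q' <= qdim p')%N.
  move=> [f [bf _]]; rewrite /qdim -(linfun_inj_dim {: _} (bij_inj bf)).
  exact/dimvS/subvf.
by move=> h; apply/eqP; rewrite eqn_leq !le //; apply: isometric_sym.
Qed.

Lemma qdim_pfister n (b : 'I_n -> F) a : qdim (@pfister F n.+1 b a) = (2 ^ n.+1)%N.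
Proof.
rewrite /pfister (big_morph (@qdim F) qdim_osum qdim_qzero).
under eq_bigr => i _ do rewrite (_ : qdim _ = 2%N) ?[qdim _]qdim_binary //.
by rewrite sum_nat_const card_ffun card_bool card_ord expnSr.
Qed.

End Dimension.

(** * Splitting off hyperbolic planes *)

Section AnisotropicPart.
Variable F : fieldType.
Implicit Types q p : qspace F.

(** Compare q(2v) = 4 q(v) with q(v + v) = 2 q(v) + B(v, v). *)
Lemma polar_isotropic q v : q v = 0 -> polar q v v = 0.
Proof.
move=> qv; have := quad_scale (1 + 1) v.
by rewrite scalerDl !scale1r quadD qv mulr0 !add0r.
Qed.

(** An isotropic vector v is completed to a hyperbolic pair v, w; the complement [p] is the
    restriction of q to the orthogonal of both. *)
Lemma isotropic_split q : nonsingular q -> ~ anisotropic q ->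
  exists p, nonsingular p /\ isometric q (osum (hyperbolic_plane F) p).
Proof.
move=> nq nan.
have [v [v0 qv]] : exists v, v != 0 /\ q v = 0.
  apply: contrapT => h; apply: nan => v v0; apply/eqP => qv.
  by apply: h; exists v.
have vv := polar_isotropic qv.
have [w [qw vw]] : exists w, q w = 0 /\ polar q v w = 1.
  have [w0 vw0] : exists w, polar q v w != 0.
    apply: contrapT => h; move/eqP: v0; apply; apply: nq => w.
    by apply: contrapT => /eqP h'; apply: h; exists w.
  have [w1 vw1] : exists w, polar q v w = 1.
    by exists ((polar q v w0)^-1 *: w0); rewrite polarZr mulVf.
  (* As q(v) = 0 and B(v, w1) = 1, adding t v to w1 changes q by t and leaves the pairing with v
     unchanged. *)
  exists (w1 + (- q w1) *: v); split.
    by rewrite quadD quad_scale qv polarZr polarC vw1; ring.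
  by rewrite polarDr polarZr vv vw1; ring.
have ww := polar_isotropic qw.
have wv : polar q w v = 1 by rewrite polarC.
pose B x : F^o * F^o := (polar q v x : F^o, polar q w x : F^o).
have lB : linear B.
  by move=> a x y; rewrite /B !polarDr !polarZr.
pose g : {linear qcarrier q -> (F^o * F^o)%type} :=
  HB.pack B (GRing.isLinear.Build _ _ _ _ B lB).
pose U := lker (linfun g).
have UP x : reflect (polar q v x = 0 /\ polar q w x = 0) (x \in U).
  rewrite memv_ker lfunE /= /B; apply: (iffP eqP).
    by case.
  by case=> -> ->.
have quadU : is_quadratic (fun u : subvs_of U => q (vsval u)).
  apply: is_quadraticI => [a u|u a u1 u2].
    by rewrite linearZ quad_scale.
  by rewrite /polar !linearD !linearZ -!/(polar q _ _) polarDr polarZr.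
pose p := QSpace quadU.
have iso : isometric (osum (hyperbolic_plane F) p) q.
  (* The plane is x(x + y) while q(s v + t w) = s t, hence s = x and t = x + y. *)
  apply: (@isometricI _ (osum (hyperbolic_plane F) p) q
    (fun x => x.1.1 *: v + (x.1.1 + x.1.2) *: w + vsval x.2)).
  - move=> a [[x y] u] [[x' y'] u'] /=.
    have -> : a *: x + x' + (a *: y + y') = a * (x + y) + (x' + y').
      by rewrite /GRing.scale /=; ring.
    have -> : a *: x + x' = a * x + x' :> F by [].
    rewrite (scalerDl v (a * x)) (scalerDl w (a * (x + y))) -!scalerA.
    by rewrite [X in X + _ = _]addrACA [LHS]addrACA -!scalerDr.
  (* Orthogonal projection onto U: the coefficient of v is the pairing with w, and conversely. *)
  - pose pr x := x - polar q w x *: v - polar q v x *: w.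
    have prU x : pr x \in U.
      apply/UP; rewrite /pr -!scaleNr !polarDr !polarZr vv vw ww wv.
      by split; ring.
    exists (fun x => ((polar q w x : F^o, polar q v x - polar q w x : F^o),
                      vsproj U (pr x))).
      move=> [[x y] u] /=; have /UP [vu wu] := subvsP u.
      rewrite !polarDr !polarZr vv vw ww wv vu wu /=.
      congr (_, _, _); [by ring | by ring |].
      apply: val_inj; rewrite /= vsprojK ?prU // /pr.
      rewrite !polarDr !polarZr vv vw ww wv vu wu !mulr0 !mulr1 !addr0 !add0r.
      by rewrite -addrA -opprD addrC addKr.
    move=> x /=; rewrite vsprojK ?prU // /pr subrKC.
    by rewrite -(addrA x) -opprD subrKC.
  - move=> [[x y] u] /=; have /UP [vu wu] := subvsP u.
    rewrite /osum_fun /= /binary_fun /= !quadD !quad_scale !polarDl !polarZl.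
    by rewrite !polarZr qv qw vw vu wu; ring.
exists p; split; last exact: isometric_sym.
have nO := isometric_nonsingular iso nq.
(* A radical vector u of p gives the radical vector (0, u) of the sum, which is nonsingular because
   q is. *)
move=> u h; suff [] : ((0, 0), u) = 0 :> qcarrier (osum (hyperbolic_plane F) p) by [].
apply: nO => -[z u']; rewrite polar_osum /= h addr0.
by rewrite polar_binary /=; ring.
Qed.

(** Planes are split off as long as the form is isotropic; each one lowers the dimension by 2. *)
Lemma anisotropic_part q : nonsingular q ->
  exists p, [/\ nonsingular p, anisotropic p, (qdim p <= qdim q)%N & witt_equiv q p].
Proof.
have [d] := ubnP (qdim q); elim: d q => // d IH q dq nq.
have [aq|nan] := pselect (anisotropic q).
  by exists q; split=> //; apply: witt_refl.
have [p [np iso]] := isotropic_split nq nan.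
have dE : qdim q = (qdim p).+2.
  by rewrite (isometric_qdim iso) qdim_osum qdim_binary.
have [|r [nr ar dr wr]] := IH p _ np.
  by move: dq; rewrite dE ltnS => /ltnW.
exists r; split=> //; first by rewrite dE; do 2 apply: leqW.
apply: witt_trans (isometric_witt iso) _; apply: witt_trans _ wr.
apply: witt_trans (isometric_witt (osumC _ _)) _.
apply: witt_trans _ (isometric_witt (osum0 _)).
apply: witt_osum (witt_refl _) _.
exact: witt_trans (isometric_witt (isometric_sym (osum0 _))) (witt_hyperbolic F 1).
Qed.

End AnisotropicPart.

(** * Totally isotropic subspaces and universality *)

Section TotallyIsotropic.
Variable F : fieldType.
Implicit Types q p : qspace F.

(** A lower bound on the dimension suffices, since cancelling a plane loses at most one. [q] itself
    vanishes on [W], which in characteristic 2 is stronger than the vanishing of its polar form. *)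
Definition has_isotropic_dim q (d : nat) : Prop :=
  exists2 W : {vspace qcarrier q}, (d <= \dim W)%N & forall v, v \in W -> q v = 0.

Lemma isometric_isotropic_dim q p d :
  isometric q p -> has_isotropic_dim q d -> has_isotropic_dim p d.
Proof.
move=> [f [bf fq]] [W dW W0]; exists (linfun f @: W)%VS.
  by rewrite (linfun_inj_dim _ (bij_inj bf)).
by move=> _ /memv_imgP [v vW ->]; rewrite lfunE /= fq W0.
Qed.

Lemma isotropic_dim_hyperbolic n : has_isotropic_dim (hyperbolic F n) n.
Proof.
apply: isometric_isotropic_dim (pairing_hyperbolic F n) _.
(* In the model [pairing], the first factor is a totally isotropic subspace of dimension n. *)
pose f (x : 'rV[F]_n) : 'rV[F]_n * 'rV[F]_n := (x, 0).
have lf : linear f by move=> a x y; rewrite /f; congr pair; rewrite /= scaler0 addr0.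
pose g : {linear _ -> _} := HB.pack f (GRing.isLinear.Build _ _ _ _ f lf).
exists (linfun g @: fullv)%VS.
  rewrite (@linfun_inj_dim _ _ _ g); last by move=> x y [].
  by rewrite dimvf /dim /= mul1n.
move=> _ /memv_imgP [v _ ->]; rewrite lfunE /= /pairing_fun big1 // => i _.
by rewrite /= mxE mulr0.
Qed.

(* Intersect with the orthogonal of the isotropic vector e = (0, 1) of the
   plane and project to q: one dimension is lost in the intersection if e is
   not in W, in the projection if it is. *)
Lemma isotropic_dim_cancel_plane q d :
  has_isotropic_dim (osum (hyperbolic_plane F) q) d.+1 -> has_isotropic_dim q d.
Proof.
move=> [W dW W0].
pose V := qcarrier q; pose X := ((F^o * F^o) * V)%type.
(* The first coordinate is the pairing with e = (0, 1), so the kernel of [g1] is the orthogonal of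
   e. *)
pose f1 (x : X) : F^o := x.1.1.
have lf1 : linear f1 by [].
pose g1 : {linear X -> F^o} := HB.pack f1 (GRing.isLinear.Build _ _ _ _ f1 lf1).
pose f2 (x : X) : V := x.2.
have lf2 : linear f2 by [].
pose g2 : {linear X -> V} := HB.pack f2 (GRing.isLinear.Build _ _ _ _ f2 lf2).
pose W1 : {vspace X} := (W :&: lker (linfun g1))%VS.
have W1P x : x \in W1 -> x \in (W : {vspace X}) /\ x.1.1 = 0.
  by rewrite memv_cap memv_ker lfunE /= => /andP [-> /eqP].
pose e : X := ((0, 1), 0).
have quadE (x : X) : osum (hyperbolic_plane F) q x =
    x.1.1 ^+ 2 + x.1.1 * x.1.2 + q x.2.
  by rewrite /= /osum_fun /= /binary_fun mul0r addr0.
exists (linfun g2 @: W1)%VS; last first.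
  move=> _ /memv_imgP [x /W1P [xW x1] ->]; rewrite lfunE /= /f2.
  by have := W0 x xW; rewrite quadE x1 expr0n mul0r !add0r.
have d1 := limg_ker_dim (linfun g1) W; rewrite -/W1 in d1.
have d2 := limg_ker_dim (linfun g2) W1.
have k2P x : x \in (W1 :&: lker (linfun g2))%VS ->
    x \in (W : {vspace X}) /\ x = x.1.2 *: e.
  rewrite memv_cap memv_ker lfunE /= => /andP [/W1P [xW x1] /eqP x2].
  split=> //; case: x x1 x2 {xW} => [[x y] u] /= -> ; rewrite /f2 /= => ->.
  by rewrite (_ : y *: e = ((y * 0, y * 1), y *: 0)) // mulr0 mulr1 scaler0.
case: (boolP (e \in (W : {vspace X}))) => eW.
  have dk : (\dim (W1 :&: lker (linfun g2)) <= 1)%N.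
    apply: leq_trans (dimvS (_ : _ <= <[e]>)%VS) _.
      by apply/subvP => x /k2P [_ ->]; rewrite memvZ ?memv_line.
    by rewrite dim_vline leq_b1.
  have W1E : W1 = W.
    apply/eqP; rewrite eqEsubv capvSl /=; apply/subvP => x xW.
    rewrite memv_cap xW memv_ker lfunE /= /f1 /=.
    (* The form vanishes at x and at x + e, and its two values differ by [x.1.1]. *)
    have := W0 _ (memvD xW eW); rewrite quadE /= !addr0 mulrDr mulr1.
    by have := W0 _ xW; rewrite quadE => h; rewrite addrA (addrAC _ x.1.1) h add0r => ->.
  rewrite -ltnS (leq_trans dW) // -[X in \dim X]W1E -d2 -add1n leq_add2r.
  exact: dk.
have /eqP dk : \dim (W1 :&: lker (linfun g2)) == 0%N.
  rewrite dimv_eq0 -subv0; apply/subvP => x /k2P [xW xE].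
  rewrite memv0 xE scaler_eq0; apply/orP; left; apply: contraNT eW => y0.
  by rewrite -[e](scalerK y0) memvZ // -xE.
move: d2; rewrite dk add0n => ->.
have : (\dim (linfun g1 @: W) <= 1)%N.
  by apply: leq_trans (dimvS (subvf _)) _; rewrite dimvf.
by move=> h; rewrite -ltnS (leq_trans dW) // -d1 -addn1 leq_add2l.
Qed.

Lemma isotropic_dim_cancel q m d :
  has_isotropic_dim (osum q (hyperbolic F m)) (m + d) -> has_isotropic_dim q d.
Proof.
elim: m d => [|m IH] d h; first exact: isometric_isotropic_dim (osum0 _) h.
apply: IH; apply: isotropic_dim_cancel_plane; apply: isometric_isotropic_dim h.
apply: isometric_trans (osumA _ _ _) _.
apply: isometric_trans _ (isometric_sym (osumA _ _ _)).
exact: isometric_osum (osumC _ _) (isometric_refl _).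
Qed.

Lemma qdim_hyperbolic n : qdim (hyperbolic F n) = n.*2.
Proof.
elim: n => [|n IH]; first exact: qdim_qzero.
by rewrite /= qdim_osum IH qdim_binary.
Qed.

(** If q plus m planes is isometric to n planes, then n = m + d by dimension. The n planes have an
    isotropic subspace of dimension n, and cancelling m planes leaves dimension d; Witt cancellation
    of forms is avoided. *)
Lemma witt_trivial_isotropic_dim q d : qdim q = d.*2 ->
  witt_equiv q (qzero F) -> has_isotropic_dim q d.
Proof.
move=> dq [m [n h]].
have h' := isometric_trans h (isometric_trans (osumC _ _) (osum0 _)).
apply: (@isotropic_dim_cancel q m).
have := isometric_qdim h'; rewrite qdim_osum !qdim_hyperbolic dq -doubleD.
move=> /double_inj e; rewrite addnC e.
exact: isometric_isotropic_dim (isometric_sym h') (isotropic_dim_hyperbolic n).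
Qed.

Lemma anisotropic_universal q : anisotropic q -> (0 < qdim q)%N ->
  (forall c, c != 0 -> witt_equiv (osum q (qscale c q)) (qzero F)) -> universal q.
Proof.
move=> aq dq hq e e0.
have [v v0] : exists v : qcarrier q, v != 0.
  exists (vpick {: qcarrier q}); rewrite vpick0 -dimv_eq0 -lt0n; exact: dq.
(* Chosen so that q(v) = - c q(w) forces q(w) = e. *)
have d0 := aq v v0; pose c := - (q v / e).
have c0 : c != 0 by rewrite oppr_eq0 mulf_neq0 ?invr_eq0.
have dE : qdim (osum q (qscale c q)) = (qdim q).*2 by rewrite qdim_osum addnn.
have [W dW W0] := witt_trivial_isotropic_dim dE (hq c c0).
pose V := qcarrier q.
pose f (x : V * V) : V := x.1.
have lf : linear f by [].
pose g : {linear (V * V)%type -> V} := HB.pack f (GRing.isLinear.Build _ _ _ _ f lf).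
(* The first projection is injective on W, because (0, y) in W gives c q(y) = 0 and hence y = 0; it
   is onto since dim W is at least dim q. *)
have full : (linfun g @: (W : {vspace V * V}))%VS = fullv.
  apply/eqP; rewrite eqEdim subvf andTb limg_dim_eq //.
  apply/eqP; rewrite -subv0; apply/subvP => -[x y].
  rewrite memv_cap memv_ker lfunE /= /f /= memv0 => /andP [xyW /eqP x0].
  have := W0 _ xyW; rewrite /= /osum_fun /= x0 quad0 add0r /qscale_fun => /eqP.
  rewrite mulf_eq0 (negPf c0) /= => qy.
  by have [->|/aq] := eqVneq y 0; last by rewrite qy.
have : v \in (linfun g @: (W : {vspace V * V}))%VS by rewrite full memvf.
move=> /memv_imgP [[x w] xwW]; rewrite lfunE /= /f /= => vE; exists w.
have := W0 _ xwW; rewrite /= /osum_fun /= -vE /qscale_fun /c mulNr => /eqP.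
rewrite subr_eq0 -mulrA => /eqP h; have : 1 = e^-1 * q w.
  by apply: (mulfI d0); rewrite mulr1.
by move=> h1; rewrite -[LHS](mulVKf e0) -h1 mulr1.
Qed.

Lemma qdim0_witt q : qdim q = 0%N -> witt_equiv q (qzero F).
Proof.
move=> dq; have all0 v : v = 0 :> qcarrier q.
  by apply/eqP; move/eqP: dq; rewrite dimv_eq0 -memv0 => /eqP <-; apply: memvf.
apply: isometric_witt; apply: (@isometricI _ q (qzero F) (fun=> 0)).
- by move=> a u v; rewrite scaler0 addr0.
- by exists (fun=> 0) => v; [rewrite [RHS]all0 | apply/rowP; case].
- by move=> v; rewrite [v]all0 !quad0.
Qed.

End TotallyIsotropic.

(** * Pfister forms at the level nu(F) *)

Lemma subgroup_span_trivial (A : zmodType) (S : A -> Prop) :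
  (forall x, S x -> x = 0) -> forall x, subgroup_span S x -> x = 0.
Proof. by move=> S0 x; elim=> // y z _ -> _ ->; rewrite subr0. Qed.

Theorem lemma3p1 (F : fieldType) (charF2 : 2%N \in [pchar F])
  (nu_neq0 : nu F <> Fin 0) :
  extnat_le (m_invariant F) (extnat_exp2 (nu F)).
Proof.
have := extnat_minP (fun n => forall w : witt_group F, Iq n.+1 w -> w = 0).
rewrite -/(nu F); case: (nu F) nu_neq0 => [[//|n] _ [I0 nmin]|_ _] /=; last first.
  by case: (m_invariant F).
(* Now [nu F] is [Fin n.+1]. By minimality I_q^(n+1) is nonzero, so one of its generators is
   nonzero. *)
have [w [[s [b [a [ns [s0 b0 wE]]]]] w0]] :
    exists w : witt_group F, scaled_pfister_class n.+1 w /\ w <> 0.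
  apply: contrapT => h; suff /nmin : forall w : witt_group F, Iq n.+1 w -> w = 0.
    by rewrite ltnn.
  apply: subgroup_span_trivial => x Sx.
  by apply: contrapT => x0; apply: h; exists x.
have [q [nq aq dq wq]] := anisotropic_part ns.
have dq0 : (0 < qdim q)%N.
  rewrite lt0n; apply/eqP => d0; apply: w0; rewrite wE -witt_class0.
  by apply/witt_classP; apply: witt_trans wq (qdim0_witt d0).
have uq : universal q.
  apply: anisotropic_universal => // c c0.
  have nsc : nonsingular (qscale s (@pfister F n.+2 (fcons c b) a)).
    apply: nonsingular_qscale => //; apply: nonsingular_pfister => // j.
    by rewrite /fcons; case: unlift.
  (* Adding the slot c produces a generator of I_q^(n+2), which is zero. *)
  have /witt_classP triv : witt_class (NSForm nsc) = witt_class (ns_zero F).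
    apply: I0; apply: span_gen; exists s, (fcons c b), a, nsc; split=> // j.
    by rewrite /fcons; case: unlift.
  (* With phi the (n+1)-fold form, s(phi _|_ c phi) is s phi _|_ c(s phi) after commuting s and c,
     and s phi is Witt equivalent to q. *)
  apply: witt_trans _ triv; apply: witt_sym.
  apply: witt_trans (isometric_witt (isometric_qscale s (pfister_cons c b a))) _.
  apply: witt_trans (isometric_witt (qscale_osum _ _ _)) _.
  apply: witt_osum => //; apply: witt_trans _ (witt_qscale c0 wq).
  apply: witt_trans (isometric_witt (qscaleA _ _ _)) _; rewrite mulrC.
  exact: isometric_witt (isometric_sym (qscaleA _ _ _)).
have := extnat_minP (fun d => exists q : qspace F,
    [/\ qdim q = d, nonsingular q, anisotropic q & universal q]).
rewrite -/(m_invariant F); case: (m_invariant F) => [m [_ mmin]|no] /=.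
  apply: leq_trans (mmin (qdim q) _) (leq_trans dq _); first by exists q.
  by rewrite -(qdim_pfister b a).
(* The form q itself excludes an infinite m-invariant. *)
by case: (no (qdim q)); exists q.
Qed.
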